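(* There exist voting trees $\Sigma$ and $\Pi$, with leaves labeled by elements of $\{0,1,2,X,Y\}$, with the following property. Let $T$ be an arbitrary non-transitive tournament on the vertex set $\mathbb{F}_3=\{0,1,2\}$ (i.e., one of the two cyclic orientations of the vertex set), and let $x$ and $y$ be arbitrary elements of $\mathbb{F}_3$. If all occurrences of the labels $X$ and $Y$ in $\Sigma$ and $\Pi$ are replaced by $x$ and $y$ respectively, and both trees are evaluated on $T$, then their outputs are precisely the elements $x+y$ and $xy$ of $\mathbb{F}_3$, respectively.
   Context: A tournament is an oriented complete graph: every pair of distinct vertices spans exactly one directed edge; $\overrightarrow{ij}\in T$ means that $i$ beats $j$. The match between $i$ and $j$ on $T$ returns $i$ if $i=j$ or $\overrightarrow{ij}\in T$, and returns $j$ otherwise. A voting tree is a finite (not necessarily complete) binary tree in which each node has either 0 or 2 children and each leaf carries a label; several leaves may receive the same label. When all leaf labels are vertices of $T$, the tree is evaluated on $T$ by recursively labeling each internal node by the result of the match on $T$ between the labels of its two children; the label at the root is the output. Here $X$ and $Y$ are formal variables used as leaf labels. The trees $\Sigma$ and $\Pi$ do not depend on $T$, $x$, $y$. *)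

(* Defs.v *)
From mathcomp Require Import all_boot all_algebra.

Set Implicit Arguments.
Unset Strict Implicit.
Unset Printing Implicit Defensive.

(* T i j means that i beats j. *)
Definition tournament (V : eqType) (T : rel V) : Prop :=
  irreflexive T /\ (forall i j : V, i != j -> T i j (+) T j i).

Inductive voting_tree (L : Type) : Type :=
| Leaf of L
| Node of voting_tree L & voting_tree L.

Fixpoint relabel (L M : Type) (f : L -> M) (t : voting_tree L) :
    voting_tree M :=
  match t with
  | Leaf l => Leaf (f l)
  | Node t1 t2 => Node (relabel f t1) (relabel f t2)
  end.

Definition play (V : eqType) (T : rel V) (i j : V) : V :=
  if (i == j) || T i j then i else j.

Fixpoint outcome (V : eqType) (T : rel V) (t : voting_tree V) : V :=
  match t with
  | Leaf v => v
  | Node t1 t2 => play T (outcome T t1) (outcome T t2)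
  end.

Inductive label : Type :=
| Const of 'F_3
| VarX
| VarY.

Definition assign (x y : 'F_3) (l : label) : 'F_3 :=
  match l with
  | Const c => c
  | VarX => x
  | VarY => y
  end.

(* Main.v *)
Require Import Defs.
From mathcomp Require Import all_boot all_algebra.

(** Both cyclic tournaments on F_3 have one common algebraic description.  There
    is a sign [s], equal to 1 or -1, such that every [i] beats [i + s], and then
    the match is the polynomial
<<
      match(a, b) = - (a + b) + s (a - b)^2.
>>
    Indeed for [a = b] this is [-2a = a], and for [a <> b] the third vertex is
    [c = - (a + b)], which beats [c + s], and [c + s] in turn beats the remaining
    vertex [c - s].

    Everything is built from this formula, with [s] unknown to the trees.
    - A knockout of the matches of [x] against all constants yields the vertex
      [x - s] beating [x] ([outcome_beater]).  Doing so twice gives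
      [x - 2s = x + s].
    - These shifts provide a tree for [- x] ([outcome_neg]).
    - Replacing [s] by [- s] reverses the tournament, and
      [- match(- x, - y) = - (x + y) - s (x - y)^2] is the match of the reversed
      tournament.  Combining the winner with the loser of [x] and [y] cancels the
      quadratic term and leaves [x + y] ([outcome_add]).
    - [match(x, - x) = s x^2], because 2 squared is 1.  Polarization turns this
      quadratic form into a tree for the bilinear form [s x y]
      ([outcome_twisted_mul]).
    - Twisting twice removes the unknown sign: [s (s x y) 1 = x y]. *)

Set Implicit Arguments.
Unset Strict Implicit.
Unset Printing Implicit Defensive.

Import GRing.Theory.
Local Open Scope ring_scope.

Lemma F3_ind (P : 'F_3 -> Prop) : P 0 -> P 1 -> P (-1) -> forall x, P x.
Proof.
move=> P0 P1 P2 [[|[|[|//]]] lt_x].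
- by rewrite (_ : Ordinal lt_x = 0) //; apply: val_inj.
- by rewrite (_ : Ordinal lt_x = 1) //; apply: val_inj.
- by rewrite (_ : Ordinal lt_x = -1) //; apply: val_inj.
Qed.

Definition cyclic_match (s a b : 'F_3) : 'F_3 := - (a + b) + s * (a - b) ^+ 2.

(** Each orientation of the three edges is either one of the two 3-cycles, where
    [s] can be read off the edge between 0 and 1, or a linear order. *)
Lemma play_cyclic (T : rel 'F_3) :
  tournament T -> ~ transitive T ->
  exists2 s : 'F_3, s != 0 & forall a b, play T a b = cyclic_match s a b.
Proof.
move=> [irrT totT] ntrT.
have T00 := irrT 0; have T11 := irrT 1; have T22 := irrT (-1).
have := totT 0 1 isT; have := totT 1 (-1) isT; have := totT (-1) 0 isT.
case T01: (T 0 1); case T12: (T 1 (-1)); case T20: (T (-1) 0);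
case T10: (T 1 0); case T21: (T (-1) 1); case T02: (T 0 (-1)) => // _ _ _;
  first [ exists (if T 0 1 then 1 else -1); first (by rewrite T01);
          elim/F3_ind; elim/F3_ind; apply/eqP;
          by rewrite /play ?T01 ?T12 ?T20 ?T10 ?T21 ?T02
        | case: ntrT; elim/F3_ind; elim/F3_ind; elim/F3_ind;
          by rewrite ?T00 ?T11 ?T22 ?T01 ?T12 ?T20 ?T10 ?T21 ?T02 ].
Qed.

Notation ltree := (voting_tree label).
Notation cst c := (Leaf (Const c)).

Definition beater (t : ltree) : ltree :=
  Node (Node (cst 0) t) (Node (Node (cst 1) t) (Node (cst (-1)) t)).

(** The winner of 0 and [x] has to be corrected to [- x], the third vertex.  This
    is done by a match against a vertex that is [- s] for [x = s] and [s]
    otherwise.  The inner match of [x] with [- s] gives [s] for [x = s] and [- s]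
    otherwise, and [z |-> match(- s, z - s)] exchanges [s] and [- s].  The vertex
    [- s] itself is the one beating 0. *)
Definition neg (t : ltree) : ltree :=
  Node (Node (cst 0) t)
       (Node (beater (cst 0)) (beater (Node t (beater (cst 0))))).

(** Let [p] be the winner and [q] the loser of [x] and [y].  The inner match is
    between [p] and [q + s], and it returns [- (x + y)].  If [x = y], it is won by
    [p = x = - (x + y)], which beats [p + s].  Otherwise [q = p + s], so that
    [q + s = p - s] is the third vertex [- (x + y)], and it beats [p]. *)
Definition add (t u : ltree) : ltree :=
  neg (Node (Node t u) (beater (beater (neg (Node (neg t) (neg u)))))).

Definition twisted_square (t : ltree) : ltree := Node t (neg t).

(** Polarization: [(x + y)^2 - (x - y)^2 = 4 x y = x y]. *)
Definition twisted_mul (t u : ltree) : ltree :=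
  add (twisted_square (add t u)) (neg (twisted_square (add t (neg u)))).

Definition mul (t u : ltree) : ltree := twisted_mul (twisted_mul t u) (cst 1).

Section Outcomes.

Variables (T : rel 'F_3) (s : 'F_3) (x y : 'F_3).
Hypothesis s_neq0 : s != 0.
Hypothesis playE : forall a b, play T a b = cyclic_match s a b.

Let value (t : ltree) : 'F_3 := outcome T (relabel (assign x y) t).

Let value_node t u : value (Node t u) = cyclic_match s (value t) (value u).
Proof. exact: playE. Qed.

Let value_cst c : value (cst c) = c.
Proof. by []. Qed.

(** Two of the three matches are won by [x] and one by [x - s], which beats [x]
    and therefore wins any knockout among them. *)
Lemma outcome_beater t : value (beater t) = value t - s.
Proof.
rewrite !value_node !value_cst; apply/eqP.
by move: s_neq0 (value t); elim/F3_ind: s => // _; elim/F3_ind.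
Qed.

Lemma outcome_neg t : value (neg t) = - value t.
Proof.
rewrite !(value_node, outcome_beater, value_cst); apply/eqP.
by move: s_neq0 (value t); elim/F3_ind: s => // _; elim/F3_ind.
Qed.

Lemma outcome_add t u : value (add t u) = value t + value u.
Proof.
rewrite !(value_node, outcome_beater, outcome_neg); apply/eqP.
by move: s_neq0 (value t) (value u); elim/F3_ind: s => // _;
  elim/F3_ind; elim/F3_ind.
Qed.

Lemma outcome_twisted_square t : value (twisted_square t) = s * value t ^+ 2.
Proof.
rewrite value_node outcome_neg /cyclic_match subrr oppr0 add0r opprK.
by congr (s * _); apply/eqP; elim/F3_ind: (value t).
Qed.

Lemma outcome_twisted_mul t u :
  value (twisted_mul t u) = s * (value t * value u).
Proof.
rewrite !(outcome_add, outcome_neg, outcome_twisted_square) -mulrBr.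
by congr (s * _); apply/eqP; elim/F3_ind: (value t); elim/F3_ind: (value u).
Qed.

Lemma outcome_mul t u : value (mul t u) = value t * value u.
Proof.
rewrite !outcome_twisted_mul value_cst mulr1 mulrA.
suff -> : s * s = 1 by rewrite mul1r.
by apply/eqP; move: s_neq0; elim/F3_ind: s.
Qed.

End Outcomes.

Theorem theorem1p4 :
  exists Sigma Pi : voting_tree label,
    forall T : rel 'F_3, tournament T -> ~ transitive T ->
    forall x y : 'F_3,
      outcome T (relabel (assign x y) Sigma) = x + y /\
      outcome T (relabel (assign x y) Pi) = x * y.
Proof.
exists (add (Leaf VarX) (Leaf VarY)), (mul (Leaf VarX) (Leaf VarY)).
move=> T tournT ntransT x y.
have [s s_neq0 playE] := play_cyclic tournT ntransT.
by split; [rewrite (outcome_add _ _ s_neq0 playE)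
          | rewrite (outcome_mul _ _ s_neq0 playE)].
Qed.
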